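(* For any connected graph $G$ of order $n \geq 2$ and any integer $p \geq n$, $$\tilde{\gamma}_{c}(M(G + \overline{K_p})) = p.$$
   Context: All graphs are non-empty, finite, undirected and simple. The order of a graph is its number of vertices. $\overline{K_p}$ is the edgeless graph on $p$ vertices, and $G + \overline{K_p}$ is the join: the disjoint union of $G$ and $\overline{K_p}$ together with all edges between $V(G)$ and $V(\overline{K_p})$. A dominating set of a graph $H$ is a set $S \subseteq V(H)$ such that $N_H[v] \cap S \neq \emptyset$ for every $v \in V(H)$, where $N_H[v]$ is the closed neighborhood of $v$. A dominating set $S$ of $H$ is an outer-connected dominating set if the graph $H - S$ (obtained by deleting the vertices in $S$) is connected. The outer-connected domination number $\tilde{\gamma}_c(H)$ is the minimum cardinality of an outer-connected dominating set of $H$. The middle graph $M(G)$ of a graph $G$ is the graph with vertex set $V(G) \cup E(G)$ (disjoint union), in which two vertices $x,y$ are adjacent if and only if either $x,y \in E(G)$ are distinct edges sharing an endpoint in $G$, or one of them is a vertex of $G$ and the other is an edge of $G$ incident with it. *)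

(* Defs.v *)
From HB Require Import structures.
From mathcomp Require Import all_boot.

Set Implicit Arguments.
Unset Strict Implicit.
Unset Printing Implicit Defensive.

(* Non-emptiness is not a field: it is part of [connected] below, and follows
   from the hypotheses on the order wherever a graph is quantified over. *)
Record sgraph := SGraph {
  vertex :> finType;
  adj : rel vertex;
  adj_sym : symmetric adj;
  adj_irr : irreflexive adj }.

Definition connected (G : sgraph) : bool :=
  (0 < #|G|) && [forall x : G, forall y : G, connect (@adj G) x y].

Section Induced.
Variables (G : sgraph) (A : {set G}).

Definition induced_adj : rel {x : G | x \in A} :=
  fun x y => adj (val x) (val y).

Fact induced_sym : symmetric induced_adj.
Proof. by move=> x y; rewrite /induced_adj adj_sym. Qed.

Fact induced_irr : irreflexive induced_adj.
Proof. by move=> x; rewrite /induced_adj adj_irr. Qed.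

Definition induced : sgraph := SGraph induced_sym induced_irr.
End Induced.

Definition delete (G : sgraph) (S : {set G}) : sgraph := induced (~: S).

Section Edgeless.
Variable p : nat.

Definition edgeless_adj : rel 'I_p := fun _ _ => false.

Fact edgeless_sym : symmetric edgeless_adj. Proof. by []. Qed.
Fact edgeless_irr : irreflexive edgeless_adj. Proof. by []. Qed.

Definition edgeless : sgraph := SGraph edgeless_sym edgeless_irr.
End Edgeless.

Section Join.
Variables G H : sgraph.

Definition join_adj : rel (G + H)%type := fun x y =>
  match x, y with
  | inl a, inl b => adj a b
  | inr a, inr b => adj a b
  | _, _ => true
  end.

Fact join_sym : symmetric join_adj.
Proof. by move=> [a|a] [b|b] //=; rewrite adj_sym. Qed.

Fact join_irr : irreflexive join_adj.
Proof. by move=> [a|a] /=; rewrite adj_irr. Qed.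

Definition join : sgraph := SGraph join_sym join_irr.
End Join.

Section Middle.
Variable G : sgraph.

Definition is_edge (e : {set G}) : bool :=
  [exists x : G, exists y : G, adj x y && (e == [set x; y])].

Definition edge : finType := {e : {set G} | is_edge e}.

Definition middle_adj : rel (G + edge)%type := fun x y =>
  match x, y with
  | inl _, inl _ => false
  | inl v, inr e => v \in val e
  | inr e, inl v => v \in val e
  | inr e, inr f =>
      (e != f) && [exists v : G, (v \in val e) && (v \in val f)]
  end.

Fact middle_sym : symmetric middle_adj.
Proof.
move=> [a|e] [b|f] //=; rewrite eq_sym; congr (_ && _).
by apply: eq_existsb => v; rewrite andbC.
Qed.

Fact middle_irr : irreflexive middle_adj.
Proof. by move=> [a|e] //=; rewrite eqxx. Qed.

Definition middle : sgraph := SGraph middle_sym middle_irr.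
End Middle.

Section OuterConnectedDomination.
Variable H : sgraph.

Definition closed_nbhd (v : H) : {set H} := [set u | (u == v) || adj v u].

Definition dominating (S : {set H}) : bool :=
  [forall v : H, closed_nbhd v :&: S != set0].

Definition oc_dominating (S : {set H}) : bool :=
  dominating S && connected (delete S).

(* [setT] is never outer-connected (graphs are non-empty): it is only the
   fallback value when H has no outer-connected dominating set, which happens
   exactly when H has no edge. *)
Definition oc_dom_number : nat :=
  #|[arg min_(S < [set: H] | oc_dominating S) #|S|]|.

Lemma oc_dom_numberP (S0 : {set H}) : oc_dominating S0 ->
  (exists2 S, oc_dominating S & #|S| = oc_dom_number) /\
  (forall S, oc_dominating S -> oc_dom_number <= #|S|).
Proof.
move=> S0oc; rewrite /oc_dom_number /arg_min /extremum.
case: pickP => [S /andP[Soc /forallP Smin] | none] /=.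
  by split=> [|U Uoc]; [exists S | apply: (implyP (Smin U))].
case: (arg_minnP (fun S : {set H} => #|S|) S0oc) => S Soc Smin.
have /negP[] := negbT (none S); rewrite /= Soc /=.
by apply/forallP=> U; apply/implyP=> /Smin.
Qed.
End OuterConnectedDomination.

(* Main.v *)
Require Import Defs.
From mathcomp Require Import all_boot.

(** The two bounds have independent reasons.

    Lower bound: in the middle graph of [G + edgeless p], the closed
    neighborhood of an added vertex [inr i] is that vertex together with its
    incident edges.  No edge joins two added vertices, so these [p] closed
    neighborhoods are pairwise disjoint, and a dominating set meets each of
    them ([packing_le_dominating]).

    Upper bound: as [p >= #|G|], there is a surjection [f] from the added
    vertices to [G]; the outer-connected dominating set consists of the [p]
    edges joining [inr i] to [f i].  They cover every vertex of the join, and a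
    set of edges covering all vertices dominates the middle graph
    ([edge_cover_dominating]).  Removing a set of edges from the middle graph
    leaves it connected as soon as the other edges still connect the base graph
    ([spare_connected_delete]).  They do so here: the edges of [G] are all kept
    and [G] is connected, and each [inr i] keeps an edge to every vertex of [G]
    other than [f i], of which there is one because [#|G| >= 2]. *)

Lemma edge_pairP (G : sgraph) (x y : G) : adj x y -> is_edge [set x; y].
Proof.
by move=> xy; apply/existsP; exists x; apply/existsP; exists y; rewrite xy eqxx.
Qed.

Definition mk_edge (G : sgraph) (x y : G) (xy : adj x y) : edge G :=
  exist (fun e => is_true (is_edge e)) [set x; y] (edge_pairP _ _ _ xy).

Lemma edgeP (G : sgraph) (e : edge G) :
  exists x y : G, adj x y /\ val e = [set x; y].
Proof.
by case: e => e /= /existsP[x /existsP[y /andP[xy /eqP ->]]]; exists x, y.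
Qed.

Lemma connect_adj_sym (G : sgraph) : connect_sym (@adj G).
Proof. by apply: sym_connect_sym; apply: adj_sym. Qed.

(** Lower bounds for domination come from packings of closed neighborhoods: a
    choice of one element of [S] in each of them is injective. *)
Lemma packing_le_dominating (H : sgraph) (I : finType) (u : I -> H)
    (S : {set H}) :
  (forall i j w, w \in closed_nbhd (u i) -> w \in closed_nbhd (u j) -> i = j) ->
  dominating S -> #|I| <= #|S|.
Proof.
move=> packing /forallP Sdom.
have S_meets i : exists w, w \in closed_nbhd (u i) :&: S by apply/set0Pn.
pose s i := xchoose (S_meets i).
have sP i : s i \in closed_nbhd (u i) /\ s i \in S.
  by apply/setIP; apply: (xchooseP (S_meets i)).
have s_inj : injective s.
  move=> i j s_ij; apply: (packing i j (s i)); first exact: (sP i).1.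
  by rewrite s_ij; exact: (sP j).1.
rewrite -(card_imset predT s_inj); apply: subset_leq_card.
by apply/subsetP=> _ /imsetP[i _ ->]; exact: (sP i).2.
Qed.

(** An edge [e] is dominated by an edge of [F] covering an endpoint of [e],
    which is either [e] itself or a neighbor of [e] in the middle graph. *)
Lemma edge_cover_dominating (H : sgraph) (F : {set edge H}) :
  (forall v : H, exists2 e, e \in F & v \in val e) ->
  dominating ([set inr e | e in F] : {set middle H}).
Proof.
move=> cover; apply/forallP=> -[v | e]; apply/set0Pn.
  have [f Ff vf] := cover v; exists (inr f).
  rewrite inE imset_f // andbT inE; exact: vf.
have [x [y [_ e_xy]]] := edgeP _ e.
have [f Ff xf] := cover x; exists (inr f).
rewrite inE imset_f // andbT inE.
have [-> | ne_ef] := eqVneq e f; first by rewrite eqxx.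
apply/orP; right; rewrite /= ne_ef; apply/existsP; exists x.
by rewrite xf andbT e_xy !inE eqxx.
Qed.

Definition spare_adj (H : sgraph) (F : {set edge H}) : rel H :=
  fun x y => adj x y && ([set x; y] \notin [set val e | e in F]).

(** A step of [spare_adj] is subdivided in the middle graph by an edge that
    survives the deletion, and each surviving edge is adjacent to its
    endpoints, none of which is deleted. *)
Lemma spare_connected_delete (H : sgraph) (F : {set edge H}) :
  0 < #|H| -> (forall x y : H, connect (spare_adj H F) x y) ->
  connected (delete ([set inr e | e in F] : {set middle H})).
Proof.
set S : {set middle H} := [set _ | _ in _] => H_gt0 Hconn.
have vert_kept v : inl v \in ~: S by rewrite inE; apply/imsetP=> -[].
pose vert v : delete S := exist _ (inl v) (vert_kept v).
have vert_connect x y : connect (@adj (delete S)) (vert x) (vert y).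
  have /connectP[q q_path ->] := Hconn x y.
  elim: q x q_path => [|z q IHq] x //= /andP[/andP[xz xzF] /IHq].
  apply: connect_trans.
  have edge_kept : inr (mk_edge H x z xz) \in ~: S.
    rewrite inE; apply: contra xzF => /imsetP[e Fe [exz]].
    by apply/imsetP; exists e; rewrite // -exz.
  apply: (@connect_trans _ _ (exist _ (inr (mk_edge H x z xz)) edge_kept)).
    by apply: connect1; rewrite /= /induced_adj /= !inE eqxx.
  by apply: connect1; rewrite /= /induced_adj /= !inE eqxx orbT.
have near_vert (a : delete S) : exists v, connect (@adj (delete S)) a (vert v).
  case: a => -[v | e] a_kept.
    by exists v; rewrite (_ : exist _ _ _ = vert v) //; apply: val_inj.
  have [x [y [_ e_xy]]] := edgeP _ e; exists x.
  by apply: connect1; rewrite /= /induced_adj /= e_xy !inE eqxx.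
have /card_gt0P[v0 _] := H_gt0.
apply/andP; split; first by apply/card_gt0P; exists (vert v0).
apply/forallP=> a; apply/forallP=> b.
have [[x ax] [y b_y]] := (near_vert a, near_vert b).
apply: connect_trans ax _; apply: connect_trans (vert_connect x y) _.
by rewrite connect_adj_sym.
Qed.

Lemma card_le_surjection (T : finType) (p : nat) :
  0 < #|T| <= p -> exists f : 'I_p -> T, forall x, exists i, f i = x.
Proof.
case/andP=> /card_gt0P[x0 _] le_Tp.
exists (fun i => nth x0 (enum T) i) => x.
have x_lt : index x (enum T) < p.
  by apply: leq_trans le_Tp; rewrite cardE index_mem mem_enum.
by exists (Ordinal x_lt); rewrite nth_index ?mem_enum.
Qed.

(** A common closed neighbor of two added vertices is either both of them or an
    edge containing both, which would have to be an edge of [edgeless p]. *)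
Lemma added_vertices_packing (G : sgraph) (p : nat) (i j : 'I_p)
    (w : middle (join G (edgeless p))) :
  w \in closed_nbhd (inl (inr i) : middle (join G (edgeless p))) ->
  w \in closed_nbhd (inl (inr j) : middle (join G (edgeless p))) -> i = j.
Proof.
case: w => [v | e]; rewrite !inE /= ?orbF.
  by move=> /eqP[->] /eqP[].
have [x [y [xy ->]]] := edgeP _ e; rewrite !inE.
move=> /orP[]/eqP xi /orP[]/eqP xj.
- by case: (etrans xi (esym xj)).
- by rewrite -xi -xj in xy.
- by rewrite -xi -xj in xy.
- by case: (etrans xi (esym xj)).
Qed.

Section AssignedEdges.
Variables (G : sgraph) (p : nat) (f : 'I_p -> G).
Let J := join G (edgeless p).

(** If [f] is onto, these edges cover all the vertices of the join.  As each
    added vertex gets only one, removing them leaves the join connected when [G]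
    is connected with at least two vertices. *)
Definition assigned_edge (i : 'I_p) : edge J :=
  mk_edge J (inl (f i)) (inr i) isT.

Definition assigned_edges : {set edge J} := [set assigned_edge i | i : 'I_p].

Lemma assigned_edges_cover (v : J) :
  (forall x, exists i, f i = x) ->
  exists2 e, e \in assigned_edges & v \in val e.
Proof.
move=> f_surj; case: v => [x | i].
  have [i <-] := f_surj x.
  by exists (assigned_edge i); rewrite ?imset_f // !inE eqxx.
by exists (assigned_edge i); rewrite ?imset_f // !inE eqxx orbT.
Qed.

Lemma assigned_pairP (x y : J) :
  reflect (exists i, [set x; y] = [set inl (f i); inr i])
          ([set x; y] \in [set val e | e in assigned_edges]).
Proof.
apply: (iffP imsetP) => [[_ /imsetP[i _ ->] ->] | [i ->]]; first by exists i.
by exists (assigned_edge i); rewrite ?imset_f.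
Qed.

Lemma spare_assigned_connect (x y : J) :
  connected G -> 2 <= #|G| -> connect (spare_adj J assigned_edges) x y.
Proof.
move=> /andP[_ /forallP Gconn] G_ge2.
have spare_sym : connect_sym (spare_adj J assigned_edges).
  by apply: sym_connect_sym => a b; rewrite /spare_adj adj_sym setUC.
have inl_connect a b :
    connect (spare_adj J assigned_edges) (inl a) (inl b).
  have /connectP[q q_path ->] := forallP (Gconn a) b.
  elim: q a q_path => [|c q IHq] a //= /andP[ac /IHq].
  apply: connect_trans; apply: connect1; rewrite /spare_adj /= ac /=.
  (* Assigned edges contain an added vertex, edges of [G] do not. *)
  apply/assigned_pairP=> -[i /setP/(_ (inr i))].
  by rewrite !inE eqxx orbT.
have near_inl v : exists a, connect (spare_adj J assigned_edges) v (inl a).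
  case: v => [a | i]; first by exists a.
  (* [f i] is the only vertex of [G] whose edge to [inr i] is removed. *)
  have /card_gt0P[a] : 0 < #|predC1 (f i)|.
    by rewrite -(ltn_add2l 1) -[X in _ < X + _](card1 (f i)) cardC.
  rewrite !inE => a_fi; exists a; apply: connect1; rewrite /spare_adj /=.
  apply/assigned_pairP=> -[j ij].
  have /setP/(_ (inr i)) := ij; rewrite !inE eqxx /= => /esym/eqP[eq_ij].
  have /setP/(_ (inl a)) := ij; rewrite !inE eqxx orbT orbF => /esym/eqP[a_fj].
  by rewrite a_fj eq_ij eqxx in a_fi.
have [[a xa] [b yb]] := (near_inl x, near_inl y).
apply: connect_trans xa _; apply: connect_trans (inl_connect a b) _.
by rewrite spare_sym.
Qed.

End AssignedEdges.

Theorem theorem5p6 (G : sgraph) (n p : nat)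
    (Gconn : connected G) (Gorder : #|G| = n) (n_ge2 : 2 <= n)
    (le_np : n <= p) :
  oc_dom_number (middle (join G (edgeless p))) = p.
Proof.
have G_gt0 : 0 < #|G| by rewrite Gorder ltnW.
have [f f_surj] : exists f : 'I_p -> G, forall x, exists i, f i = x.
  by apply: card_le_surjection; rewrite G_gt0 Gorder.
pose S : {set middle (join G (edgeless p))} :=
  [set inr e | e in assigned_edges G p f].
have S_oc : oc_dominating S.
  apply/andP; split.
    by apply: edge_cover_dominating => v; apply: assigned_edges_cover.
  apply: spare_connected_delete => [|x y].
    by have /card_gt0P[a _] := G_gt0; apply/card_gt0P; exists (inl a).
  by apply: spare_assigned_connect; rewrite ?Gorder.
have S_le : #|S| <= p.
  apply: leq_trans (leq_imset_card _ _) _.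
  by apply: leq_trans (leq_imset_card _ _) _; rewrite card_ord.
have [[U /andP[U_dom _] U_card] oc_min] := oc_dom_numberP S_oc.
apply/eqP; rewrite eqn_leq (leq_trans (oc_min S S_oc) S_le) -U_card.
rewrite -[X in X <= _](card_ord p).
exact: packing_le_dominating (added_vertices_packing G p) U_dom.
Qed.
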